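(* Let the hypotheses be $H_0:\theta=\theta_0$ and $H_1:\theta=\theta_1$, and suppose that the derivatives of the evidence function $\mathcal{V}$ exist at $1$. Let $x_{\rm obs}$ be the observed outcome of $\xi_1$, the first part of a composite experiment $\xi=(\xi_1,\xi_2)$. Then, for univariate $\theta$ and $\theta_1=\theta_{\rm obs}$ (the maximum likelihood estimate of $\theta$ based on $x_{\rm obs}$), we have $$\mathcal{FI}^T_{\mathcal V}(\xi_2|\xi_1;H_0,H_1,x_{\rm obs})=\frac{\mathcal{V}'(1)\,I_{\rm obs}}{\mathcal{V}'(1)\,I_{\rm obs}-\mathcal{V}''(1)\,I_{\rm mis}}+O_p\big(|\theta_0-\theta_{\rm obs}|\big),$$ under the following uniform integrability condition: for a sequence $\{\theta^{(m)}\}_{m=1}^\infty$ such that $|\theta^{(m)}-\theta_1|\le\frac1m$, the sequence $\{R_3(\{x_{\rm obs},X_{\rm mis}\};\theta^{(m)},\theta_1)\}_{m=1}^\infty$ is uniformly integrable, where $R_3$ is the Taylor remainder defined in the context. Here $\mathcal{FI}^T_{\mathcal V}$ is the fraction of observed test information, and $I_{\rm obs}$ and $I_{\rm mis}$ are the observed and missing Fisher information, all defined in the context.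
   Context: **Model.** $f(\cdot|\theta)$ denotes the density of the data given $\theta$ (continuous densities with respect to Lebesgue measure), with support the same for all $\theta$. The outcome of $\xi=(\xi_1,\xi_2)$ is the complete data $X_{\rm com}=\{X_{\rm obs},X_{\rm mis}\}$, where $X_{\rm obs}$ is the outcome of $\xi_1$ (observed value $x_{\rm obs}$) and $X_{\rm mis}$ is the not yet observed outcome of $\xi_2$. The same symbol $f$ is used for the density of the observed data, of the complete data, and for conditional densities such as $f(\cdot|x_{\rm obs},\theta)$. The likelihood ratio is $\mathrm{LR}(\theta_0,\theta_1|x)=f(x|\theta_0)/f(x|\theta_1)$. **Evidence function.** An evidence function $\mathcal{V}$ is a concave real-valued function on the positive real numbers; its argument is the likelihood ratio (the Bayes factor, in the case of sharp hypotheses). **Test information (sharp hypotheses, $\theta_0\ne\theta_1$).** The observed test information provided by $\xi_1$ is $$\mathcal{I}^T_{\mathcal V}(\xi_1;x_{\rm obs})=\mathcal{V}(1)-\mathcal{V}\big(\mathrm{LR}(\theta_0,\theta_1|x_{\rm obs})\big).$$ The observed conditional test information from $\xi_2$ after observing $x_{\rm obs}$ is $$\mathcal{I}^T_{\mathcal V}(\xi_2|\xi_1;x_{\rm obs})=\mathcal{V}\big(\mathrm{LR}(\theta_0,\theta_1|x_{\rm obs})\big)-E\big[\mathcal{V}\big(\mathrm{LR}(\theta_0,\theta_1|x_{\rm obs},X_{\rm mis})\big)\,\big|\,\theta_1,x_{\rm obs}\big],$$ where the expectation is over $X_{\rm mis}\sim f(\cdot|x_{\rm obs},\theta_1)$.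 The fraction of observed test information is $$\mathcal{FI}^T_{\mathcal V}(\xi_2|\xi_1;H_0,H_1,x_{\rm obs})=\frac{\mathcal{I}^T_{\mathcal V}(\xi_1;x_{\rm obs})}{\mathcal{I}^T_{\mathcal V}(\xi_1;x_{\rm obs})+\mathcal{I}^T_{\mathcal V}(\xi_2|\xi_1;x_{\rm obs})}.$$ **Fisher information.** $I_{\rm obs}$ is the usual observed Fisher information, $I_{\rm obs}=-\frac{\partial^2}{\partial\theta^2}\log f(x_{\rm obs}|\theta)\big|_{\theta=\theta_{\rm obs}}$, and $$I_{\rm mis}=E\Big[-\frac{\partial^2\log f(X_{\rm com}|x_{\rm obs},\theta)}{\partial\theta^2}\,\Big|\,x_{\rm obs},\theta\Big]\Big|_{\theta=\theta_{\rm obs}}$$ is the missing Fisher information. **Taylor remainder.** With primes on $f$ denoting derivatives in $\theta$ and $\delta=\theta_0-\theta_1$, $R_3(x)=R_3(x;\theta_0,\theta_1)$ is the standard remainder term in the Taylor expansion in $\theta_0$ of $\mathcal{V}(1)-\mathcal{V}\big(f(x|\theta_0)/f(x|\theta_1)\big)$: $$\mathcal{V}(1)-\mathcal{V}\Big(\frac{f(x|\theta_0)}{f(x|\theta_1)}\Big)=-\Big(\delta\frac{f'(x|\theta_1)}{f(x|\theta_1)}+\frac{\delta^2}{2}\frac{f''(x|\theta_1)}{f(x|\theta_1)}\Big)\mathcal{V}'(1)-\frac{\delta^2}{2}\Big(\frac{f'(x|\theta_1)}{f(x|\theta_1)}\Big)^2\mathcal{V}''(1)+R_3(x;\theta_0,\theta_1).$$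 In the uniform integrability condition the random quantity is $X_{\rm mis}$, whose density is $f(\cdot|x_{\rm obs},\theta_{\rm obs})$. **Asymptotic regime.** The asymptotics let the distance $|\theta_0-\theta_{\rm obs}|$ between the null value and the maximum likelihood estimate go to zero, with the sample size fixed.
   Formalization: Uniform integrability is required of R_3 divided by |θ^(m)−θ_1|^3, for every such sequence (for R_3 itself the claim fails); also assumed: interior MLE, three derivatives of f(x_obs|θ), two θ-derivatives under the integral, finite I_mis, nonzero denominator. *)

(* Defs.v *)
From HB Require Import structures.
From mathcomp Require Import all_boot all_order all_algebra.
From mathcomp Require Import all_classical all_reals all_analysis.

Set Implicit Arguments.
Unset Strict Implicit.
Unset Printing Implicit Defensive.
Import Order.TTheory GRing.Theory Num.Theory.
Import numFieldNormedType.Exports.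
Local Open Scope classical_set_scope.
Local Open Scope ring_scope.

(* [derive1] is total, so [derive1n n f a] alone does not assert that the n-th
   derivative exists.  [times_derivable n f a] says that it exists at [a] in the
   usual sense: the lower derivatives exist on a neighbourhood of [a]. *)
Fixpoint times_derivable (R : realType) (n : nat) (f : R -> R) (a : R) : Prop :=
  match n with
  | 0 => True
  | 1 => derivable f a 1
  | m.+1 => (\forall t \near a, derivable f t 1) /\ times_derivable m (derive1 f) a
  end.

(* Only the restriction of [V] to the positive reals is meaningful. *)
Definition evidence_function (R : realType) (V : R -> R) : Prop :=
  convex_function (`]0, +oo[%classic : set R^o) (fun x : R^o => - V x : R^o).

(* Uniform integrability of the random variables [X m] under the law which has
   density [p] with respect to [mu]. *)
Definition uniformly_integrable (R : realType) (d : measure_display)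
    (T : measurableType d) (mu : {measure set T -> \bar R})
    (p : T -> R) (X : nat -> T -> R) : Prop :=
  (forall m, measurable_fun setT (X m) /\
     mu.-integrable setT (fun y => (X m y * p y)%:E)) /\
  (forall e : R, 0 < e -> exists K : R, forall m,
     (\int[mu]_(y in [set y | (K < `|X m y|)%R]) (`|X m y| * p y)%:E <= e%:E)%E).

Section Likelihood.
Variable R : realType.

(* In this section [L] is a likelihood, i.e. theta |-> f(x|theta) for a fixed
   data value x. *)
Definition LR (L : R -> R) (theta0 theta1 : R) : R := L theta0 / L theta1.

Definition R3 (V : R -> R) (L : R -> R) (theta0 theta1 : R) : R :=
  let delta := theta0 - theta1 in
  V 1 - V (LR L theta0 theta1)
  - (- (delta * (derive1 L theta1 / L theta1)
        + delta ^+ 2 / 2 * (derive1n 2 L theta1 / L theta1)) * derive1 V 1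
     - delta ^+ 2 / 2 * (derive1 L theta1 / L theta1) ^+ 2 * derive1n 2 V 1).

End Likelihood.

Section Model.
Context (R : realType) (d1 d2 : measure_display).
Context (Tobs : measurableType d1) (Tmis : measurableType d2).
Variables (muobs : {sigma_finite_measure set Tobs -> \bar R})
          (mumis : {sigma_finite_measure set Tmis -> \bar R}).

(* [f theta (xobs, xmis)] is the density of the complete data with respect to
   the product of the reference measures (Lebesgue measures, in the case of
   continuous data); the support does not depend on theta. *)
Definition density_model (Theta : set R) (f : R -> Tobs * Tmis -> R) : Prop :=
  (forall theta, Theta theta ->
     [/\ measurable_fun setT (f theta),
         forall x, 0 <= f theta x
       & (\int[(muobs \x mumis)%E]_x (f theta x)%:E = 1)%E]) /\
  (forall theta theta', Theta theta -> Theta theta' ->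
     forall x, (0 < f theta x) = (0 < f theta' x)).

Variables (f : R -> Tobs * Tmis -> R) (xobs : Tobs).

Definition com_likelihood (xmis : Tmis) (theta : R) : R := f theta (xobs, xmis).

Definition obs_likelihood (theta : R) : R :=
  \int[mumis]_xmis com_likelihood xmis theta.

Definition mis_density (theta : R) (xmis : Tmis) : R :=
  com_likelihood xmis theta / obs_likelihood theta.

Definition cond_expectation (theta : R) (h : Tmis -> R) : R :=
  \int[mumis]_xmis (h xmis * mis_density theta xmis).

Definition is_MLE (Theta : set R) (theta_obs : R) : Prop :=
  Theta theta_obs /\
  forall theta, Theta theta -> obs_likelihood theta <= obs_likelihood theta_obs.

Definition obs_test_info (V : R -> R) (theta0 theta1 : R) : R :=
  V 1 - V (LR obs_likelihood theta0 theta1).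

Definition cond_test_info (V : R -> R) (theta0 theta1 : R) : R :=
  V (LR obs_likelihood theta0 theta1)
  - cond_expectation theta1
      (fun xmis => V (LR (com_likelihood xmis) theta0 theta1)).

Definition fraction_test_info (V : R -> R) (theta0 theta1 : R) : R :=
  obs_test_info V theta0 theta1
  / (obs_test_info V theta0 theta1 + cond_test_info V theta0 theta1).

Definition obs_fisher (theta : R) : R :=
  - derive1n 2 (fun t => ln (obs_likelihood t)) theta.

(* Given [xobs], the complete data are determined by the missing data, so
   f(x_com|x_obs,theta) is [mis_density]. *)
Definition mis_neg_hessian (theta : R) (xmis : Tmis) : R :=
  - derive1n 2 (fun t => ln (mis_density t xmis)) theta.

Definition mis_fisher (theta : R) : R :=
  cond_expectation theta (mis_neg_hessian theta).

(* The usual regularity conditions at [theta]: the derivatives of the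
   likelihoods used in the expansion exist, the first two can be taken under
   the integral sign, and the missing Fisher information is finite. *)
Definition regular_at (theta : R) : Prop :=
  [/\ times_derivable 3 obs_likelihood theta,
      forall xmis, times_derivable 2 (com_likelihood xmis) theta,
      forall k : nat, (0 < k <= 2)%N ->
        mumis.-integrable setT
          (fun xmis => (derive1n k (com_likelihood xmis) theta)%:E) /\
        derive1n k obs_likelihood theta
          = \int[mumis]_xmis derive1n k (com_likelihood xmis) theta
    & mumis.-integrable setT
        (fun xmis => (mis_neg_hessian theta xmis * mis_density theta xmis)%:E)].

(* The remainder is divided by its order |theta0 - theta1|^3: uniform
   integrability of the remainders themselves would only give that their
   expectations tend to 0, whereas the expansion of the test information,
   whose leading term is of order |theta0 - theta1|^2, needs expectations of
   order |theta0 - theta1|^3. *)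
Definition R3_uniformly_integrable (Theta : set R) (V : R -> R) (theta1 : R)
    : Prop :=
  forall u : nat -> R,
    (forall m, [/\ Theta (u m), u m != theta1 & `|u m - theta1| <= m.+1%:R^-1]) ->
    uniformly_integrable mumis (mis_density theta1)
      (fun m xmis =>
         R3 V (com_likelihood xmis) (u m) theta1 / `|u m - theta1| ^+ 3).

End Model.

(* Main.v *)
Require Import Defs.
From HB Require Import structures.
From mathcomp Require Import all_boot all_order all_algebra.
From mathcomp Require Import all_classical all_reals all_analysis.
From mathcomp Require Import measurable_realfun ring lra.
Import Order.TTheory GRing.Theory Num.Theory.
Import numFieldNormedType.Exports.
Local Open Scope classical_set_scope.
Local Open Scope ring_scope.

(** Write l_y and L for the likelihoods of the complete and the observed data,
    a for the maximum likelihood estimate and d = theta0 - a.  Since L'(a) = 0,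
    Taylor's formula gives V(1) - V(L(a+d)/L(a)) = d^2/2 V'(1) I_obs + O(d^3),
    and I_mis = E[(l_y'/l_y)^2].  Taking the expectation of the expansion that
    defines R3 gives V(1) - E[V(LR)] = d^2/2 (V'(1) I_obs - V''(1) I_mis) + E[R3].
    If E|R3| were not O(|d|^3), there would be points u_m within 1/(m+1) of a with
    E|R3(u_m)| > m |u_m - a|^3, against uniform integrability.  Divide. *)

(** * Real calculus: Taylor bounds, logarithmic derivatives, interior maxima *)

Lemma derivable_continuous (R : realType) (f : R -> R) (a : R) :
  derivable f a 1 -> {for a, continuous f}.
Proof. by move=> /derivable1_diffP /differentiable_continuous. Qed.

Lemma derivable_lipschitz_at (R : realType) (f : R -> R) (a : R) :
  derivable f a 1 ->
  exists2 C, 0 <= C & \forall t \near a, `|f t - f a| <= C * `|t - a|.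
Proof.
move=> /cvg_ex[/= d fd].
(* The difference quotients converge to [d], so they are eventually smaller than |d| + 1 in absolute
   value. *)
exists (`|d| + 1); first by rewrite addr_ge0.
have : \forall h \near 0^', `|h^-1 * (f (h + a) - f a)| < `|d| + 1.
  have := cvgr_norm_lt _ fd (`|d| + 1); rewrite ltrDl ltr01 => /(_ _ isT).
  by apply: filterS => h; rewrite /= [h *: 1]mulr1.
rewrite near_withinE => /nbhs_ballP[r /= r0 hr].
apply/nbhs_ballP; exists r => // t; rewrite /ball/= => tr.
have [->|ta] := eqVneq t a; first by rewrite !subrr normr0 mulr0.
have := hr (t - a); rewrite /ball/= sub0r opprB subr_eq0 => /(_ tr ta).
rewrite subrK normrM normfV => /ltW.
by rewrite ler_pdivrMl ?normr_gt0 ?subr_eq0// mulrC.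
Qed.

(** The induction step of Taylor's formula: by the mean value theorem, a bound on the derivative
    gains one power of |t - a|. No integrability or continuity of [dg] is required. *)
Lemma mvt_norm_bound (R : realType) (g dg : R -> R) (a C : R) (n : nat) :
  0 <= C ->
  (\forall t \near a, is_derive (t : R) 1 g (dg t)) ->
  (\forall t \near a, `|dg t| <= C * `|t - a| ^+ n) ->
  \forall t \near a, `|g t - g a| <= C * `|t - a| ^+ n.+1.
Proof.
move=> C0 /nbhs_ballP[r1 /= r10 h1] /nbhs_ballP[r2 /= r20 h2].
apply/nbhs_ballP; exists (Num.min r1 r2); first by rewrite /= lt_min r10 r20.
move=> t; rewrite /ball/= lt_min => /andP[t1 t2].
have hd x : `|a - x| <= `|a - t| -> is_derive x 1 g (dg x).
  by move=> xt; apply: h1; rewrite /ball/=; exact: le_lt_trans t1.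
have hb x : `|a - x| <= `|a - t| -> `|dg x| <= C * `|x - a| ^+ n.
  by move=> xt; apply: h2; rewrite /ball/=; exact: le_lt_trans t2.
have [c [ct gc]] : exists c, `|a - c| <= `|a - t| /\ g t - g a = dg c * (t - a).
  have [at_|ta] := leP a t.
    have inab x : x \in `[a, t] -> `|a - x| <= `|a - t|.
      rewrite in_itv/= => /andP[ax xt].
      by rewrite distrC (distrC a t) !ger0_norm ?subr_ge0// lerD2r.
    have [||c cat ->] := @MVT_segment R g dg a t at_.
    - by move=> x xat; apply/hd/inab/subset_itv_oo_cc.
    - by apply: derivable_within_continuous => x xat; have [] := hd _ (inab _ xat).
    by exists c; split => //; exact: inab.
  have inab x : x \in `[t, a] -> `|a - x| <= `|a - t|.
    rewrite in_itv/= => /andP[ax xt].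
    by rewrite !ger0_norm ?subr_ge0 ?(ltW ta)// lerD2l lerN2.
  have [||c cat gc] := @MVT_segment R g dg t a (ltW ta).
  - by move=> x xat; apply/hd/inab/subset_itv_oo_cc.
  - by apply: derivable_within_continuous => x xat; have [] := hd _ (inab _ xat).
  exists c; split; first exact: inab.
  by rewrite -opprB gc -mulrN opprB.
rewrite gc normrM exprSr mulrA ler_wpM2r//.
apply: le_trans (hb _ ct) _.
by rewrite ler_wpM2l// lerXn2r ?nnegrE// distrC (distrC t a).
Qed.

Lemma derivable_is_derive1 (R : realType) (f : R -> R) (a : R) :
  derivable f a 1 -> is_derive a 1 f (derive1 f a).
Proof. by move=> fa; apply: DeriveDef; rewrite // derive1E. Qed.

Lemma is_derive1E (R : realType) (f : R -> R) (a d : R) :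
  is_derive a 1 f d -> derive1 f a = d.
Proof. by move=> fa; rewrite derive1E derive_val. Qed.

(** The function minus its linear part has derivative [derive1 f t - derive1 f a], which is O(|t -
    a|) as soon as [derive1 f] is differentiable at the single point [a]; the mean value bound
    raises the order to 2. *)
Lemma taylor_bound1 (R : realType) (f : R -> R) (a : R) :
  times_derivable 2 f a ->
  exists2 C, 0 <= C &
    \forall t \near a, `|f t - f a - derive1 f a * (t - a)| <= C * `|t - a| ^+ 2.
Proof.
move=> [fd /derivable_lipschitz_at[C C0 hC]]; exists C => //.
pose g t := f t - derive1 f a * (t - a).
have dg : \forall t \near a, is_derive (t : R) 1 g (derive1 f t - derive1 f a).
  near=> t.
  have ft : is_derive t 1 f (derive1 f t) by apply: derivable_is_derive1; near: t.
  rewrite /g; apply: is_derive_eq; rewrite /GRing.scale/=; ring.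
have := @mvt_norm_bound _ g _ a C 1 C0 dg hC.
by apply: filterS => t; rewrite /g subrr mulr0 subr0 addrAC.
Unshelve. all: by end_near. Qed.

(** The first-order bound for [derive1 f], raised by one order in the same way. *)
Lemma taylor_bound2 (R : realType) (f : R -> R) (a : R) :
  times_derivable 3 f a ->
  exists2 C, 0 <= C &
    \forall t \near a,
      `|f t - f a - derive1 f a * (t - a) - derive1n 2 f a / 2 * (t - a) ^+ 2|
        <= C * `|t - a| ^+ 3.
Proof.
move=> [fd /taylor_bound1[C C0 hC]]; exists C => //.
pose g t := f t - derive1 f a * (t - a) - derive1n 2 f a / 2 * (t - a) ^+ 2.
have dg : \forall t \near a,
    is_derive (t : R) 1 g (derive1 f t - derive1 f a - derive1n 2 f a * (t - a)).
  near=> t.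
  have ft : is_derive t 1 f (derive1 f t) by apply: derivable_is_derive1; near: t.
  by rewrite /g; apply: is_derive_eq; rewrite /GRing.scale/=; field.
have := @mvt_norm_bound _ g _ a C 2 C0 dg hC.
apply: filterS => t; rewrite /g subrr mulr0 expr0n mulr0 !subr0.
by congr (`|_| <= _); ring.
Unshelve. all: by end_near. Qed.

Lemma ln_derive2 (R : realType) (f : R -> R) (a : R) :
  times_derivable 2 f a -> 0 < f a ->
  times_derivable 2 (fun t => ln (f t)) a /\
  derive1n 2 (fun t => ln (f t)) a = derive1n 2 f a / f a - (derive1 f a / f a) ^+ 2.
Proof.
move=> [fd fd2] fa0.
have fpos : \forall t \near a, 0 < f t.
  have /(_ _ 0 fa0) := cvgr_gt _ (derivable_continuous _ _ _ (nbhs_singleton fd)).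
  exact.
have d1 : \forall t \near a, is_derive (t : R) 1 (fun t => ln (f t)) (derive1 f t / f t).
  near=> t.
  have ft : is_derive t 1 f (derive1 f t) by apply: derivable_is_derive1; near: t.
  have lt : is_derive (f t) 1 (@ln R) (f t)^-1 by apply: is_derive1_ln; near: t.
  by rewrite mulrC; exact: is_derive1_comp.
have d2 : is_derive a 1 (derive1 (fun t => ln (f t)))
    (derive1n 2 f a / f a - (derive1 f a / f a) ^+ 2).
  apply: (@near_eq_is_derive _ _ _ (fun t => derive1 f t / f t)).
    by near=> t; apply/esym/is_derive1E; near: t.
  have ft : is_derive a 1 f (derive1 f a) by apply: derivable_is_derive1; exact: (nbhs_singleton fd).
  have ft2 : is_derive a 1 (derive1 f) (derive1n 2 f a) by apply: derivable_is_derive1.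
  have fV := is_deriveV (lt0r_neq0 fa0) ft.
  apply: is_derive_eq; rewrite /GRing.scale/=; field.
  by rewrite gt_eqF.
split; last exact: is_derive1E.
split; last by have [] := d2.
by apply: filterS d1 => t [].
Unshelve. all: by end_near. Qed.

Lemma derive2B (R : realType) (f g : R -> R) (a : R) :
  times_derivable 2 f a -> times_derivable 2 g a ->
  derive1n 2 (fun t => f t - g t) a = derive1n 2 f a - derive1n 2 g a.
Proof.
move=> [fd fd2] [gd gd2]; apply: is_derive1E.
apply: (@near_eq_is_derive _ _ _ (fun t => derive1 f t - derive1 g t)).
  apply: filterS2 fd gd => t /derivable_is_derive1 ft /derivable_is_derive1 gt.
  by apply/esym/is_derive1E; exact: is_deriveB.
have ft2 : is_derive a 1 (derive1 f) (derive1n 2 f a) by apply: derivable_is_derive1.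
have gt2 : is_derive a 1 (derive1 g) (derive1n 2 g a) by apply: derivable_is_derive1.
exact: is_deriveB.
Qed.

Lemma near_eq_derive1n (R : realType) (f g : R -> R) (a : R) (n : nat) :
  (\forall t \near a, f t = g t) -> derive1n n f a = derive1n n g a.
Proof.
(* Equality is carried on a neighbourhood rather than at [a] alone, so that it can be differentiated
   again in the induction. *)
move=> fg; suff /nbhs_singleton : \forall t \near a, derive1n n f t = derive1n n g t by [].
elim: n => // n /near_join ih.
apply: filterS ih => t; rewrite !derive1nS !derive1E; exact: near_eq_derive.
Qed.

Lemma derive1_local_max (R : realType) (f : R -> R) (a : R) :
  (\forall t \near a, derivable f t 1) -> (\forall t \near a, f t <= f a) ->
  derive1 f a = 0.
Proof.
move=> /nbhs_ballP[r /= r0 fd] /nbhs_ballP[s /= s0 fm].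
pose e := Num.min r s; have e0 : 0 < e by rewrite lt_min r0 s0.
have inb t : t \in `]a - e, a + e[ -> `|a - t| < e.
  by rewrite in_itv/= => /andP[? ?]; rewrite ltr_norml; lra.
apply: is_derive1E; apply: (@derive1_at_max _ f (a - e) (a + e)).
- lra.
- by move=> t /inb te; apply: fd; rewrite /ball/= (lt_le_trans te)// ge_min lexx.
- by rewrite in_itv/=; lra.
- by move=> t /inb te; apply: fm; rewrite /ball/= (lt_le_trans te)// ge_min lexx orbT.
Qed.

(** * Uniform integrability gives bounded first moments *)

Lemma uniformly_integrable_bounded (R : realType) (d : measure_display)
    (T : measurableType d) (mu : {measure set T -> \bar R})
    (p : T -> R) (X : nat -> T -> R) :
  (forall y, 0 <= p y) -> mu.-integrable setT (fun y => (p y)%:E) ->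
  uniformly_integrable mu p X ->
  exists M, forall m, \int[mu]_y `|X m y * p y| <= M.
Proof.
move=> p0 ip [iX /(_ 1 ltr01)[K hK]].
(* With tolerance 1, the part where |X m| exceeds [K] contributes at most 1, and the rest at most
   |K| times the mass of [p]. The absolute value covers a negative [K]. *)
exists (1 + `|K| * \int[mu]_y p y) => m.
have [mX iXp] := iX m.
have mp : measurable_fun setT p by case/integrableP : ip => /measurable_EFinP.
have mnX : measurable_fun setT (fun y => `|X m y|) by exact: measurableT_comp.
have mA : measurable [set y | K < `|X m y|].
  have := mnX measurableT `]K, +oo[%classic (measurable_itv _).
  by rewrite setTI; congr (measurable _); apply/seteqP; split => y; rewrite /= in_itv/= andbT.
have mXp : measurable_fun setT (EFin \o (fun y => `|X m y| * p y)).
  by apply/measurable_EFinP; exact: measurable_funM.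
have Xp0 y : (0 <= (`|X m y| * p y)%:E)%E by rewrite lee_fin mulr_ge0.
have fin : (\int[mu]_y (`|X m y| * p y)%:E <= (1 + `|K| * \int[mu]_y p y)%:E)%E.
  rewrite -{1}(setvU [set y | K < `|X m y|]) ge0_integral_setU//=.
  - rewrite addeC EFinD; apply: leeD; first exact: hK.
    have -> : (`|K| * \int[mu]_y p y)%:E = (\int[mu]_y (`|K| * p y)%:E)%E.
      rewrite -RintegralZl// /Rintegral fineK//; apply: integrable_fin_num => //.
      exact: (integrableZl measurableT `|K| ip).
    have mKp : measurable_fun setT (EFin \o (fun y => `|K| * p y)).
      by apply/measurable_EFinP; exact: measurable_funM.
    apply: (@le_trans _ _ (\int[mu]_(y in ~` [set y | (K < `|X m y|)%R]) (`|K| * p y)%:E)%E).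
      apply: ge0_le_integral => //.
      - exact: measurableC.
      - exact: measurable_funTS.
      - exact: measurable_funTS.
      move=> y /= /negP; rewrite -leNgt lee_fin => XK.
      by rewrite ler_wpM2r// (le_trans XK)// ler_norm.
    apply: ge0_subset_integral => //; first exact: measurableC.
    by move=> y _; rewrite lee_fin mulr_ge0.
  - exact: measurableC.
  - by rewrite setvU.
  - by apply/disj_setPS => y [].
have -> : \int[mu]_y `|X m y * p y| = fine (\int[mu]_y (`|X m y| * p y)%:E).
  by apply: eq_Rintegral => y _; rewrite normrM (ger0_norm (p0 y)).
rewrite -lee_fin fineK// ge0_fin_numE ?integral_ge0//.
by rewrite (le_lt_trans fin)// ltry.
Qed.

(** * Expected expansion of the evidence under the law of the missing data *)

Section Expansion.
Context (R : realType) (d1 d2 : measure_display).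
Context (Tobs : measurableType d1) (Tmis : measurableType d2).
Context (mumis : {sigma_finite_measure set Tmis -> \bar R}).
Context (f : R -> Tobs * Tmis -> R) (xobs : Tobs) (a : R).

Local Notation l := (com_likelihood f xobs).
Local Notation L := (obs_likelihood mumis f xobs).
Local Notation p := (mis_density mumis f xobs a).

Hypothesis L_gt0 : \forall t \near a, 0 < L t.
Hypothesis ml : measurable_fun setT (fun y => l y a).
Hypothesis l_supp : forall y,
  \forall t \near a, 0 <= l y t /\ (0 < l y t) = (0 < l y a).
Hypothesis hreg : regular_at mumis f xobs a.
Hypothesis L_score0 : derive1 L a = 0.

Let La_gt0 : 0 < L a. Proof. exact: nbhs_singleton L_gt0. Qed.

Let l_ge0 y : 0 <= l y a. Proof. by have [] := nbhs_singleton (l_supp y). Qed.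

Lemma mis_density_ge0 y : 0 <= p y.
Proof. by rewrite /mis_density divr_ge0// ltW. Qed.

Lemma integrable_com_likelihood : mumis.-integrable setT (fun y => (l y a)%:E).
Proof.
apply/integrableP; split; first exact/measurable_EFinP.
under eq_integral => y _ do rewrite gee0_abs ?lee_fin//.
(* A real-valued integral defaults to 0 when the extended one is infinite, so [L a] being positive
   forces finiteness. *)
rewrite ltey; apply/eqP => intoo.
by move: La_gt0; rewrite /obs_likelihood /Rintegral intoo ltxx.
Qed.

Lemma integrable_mis_density : mumis.-integrable setT (fun y => (p y)%:E).
Proof.
apply: eq_integrable (integrableZl measurableT (L a)^-1 integrable_com_likelihood) => //.
by move=> y _; rewrite -EFinM mulrC.
Qed.

Lemma mis_density_total : \int[mumis]_y p y = 1.
Proof.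
rewrite /mis_density RintegralZr//; last exact: integrable_com_likelihood.
by rewrite mulfV// gt_eqF.
Qed.

(** Since the support is constant, a likelihood that vanishes at [a] vanishes on a whole
    neighbourhood of [a]. *)
Lemma derive1n_com_likelihood_eq0 y n : l y a = 0 -> derive1n n (l y) a = 0.
Proof.
move=> ly0; have -> : derive1n n (l y) a = derive1n n (cst 0) a.
  apply: near_eq_derive1n; apply: filterS (l_supp y) => t [lt0].
  by rewrite ly0 ltxx => /negbT; rewrite -leNgt => lt0'; apply/le_anti/andP.
suff -> : derive1n n (cst (0 : R)) = cst 0 by [].
by elim: n => // n ih; rewrite derive1nS ih; apply/funext => x; rewrite derive1E derive_cst.
Qed.

Lemma times_derivable_obs2 : times_derivable 2 L a.
Proof. by have [[? [? _]] _ _ _] := hreg; split => //; exact: nbhs_singleton. Qed.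

Lemma obs_fisherE : obs_fisher mumis f xobs a = - (derive1n 2 L a / L a).
Proof.
have [_ e] := ln_derive2 _ _ _ times_derivable_obs2 La_gt0.
by rewrite /obs_fisher e L_score0 mul0r expr0n subr0.
Qed.

(** Near [a] the log of the conditional density is ln l_y - ln L; differentiating twice leaves no
    square of the observed score, as that score is 0 at [a]. *)
Lemma mis_neg_hessianE y : 0 < l y a ->
  mis_neg_hessian mumis f xobs a y
  = (derive1 (l y) a / l y a) ^+ 2 - derive1n 2 (l y) a / l y a
    + derive1n 2 L a / L a.
Proof.
move=> ly0; have [_ hl _ _] := hreg.
have [dl el] := ln_derive2 _ _ _ (hl y) ly0.
have [dL eL] := ln_derive2 _ _ _ times_derivable_obs2 La_gt0.
have e : derive1n 2 (fun t => ln (mis_density mumis f xobs t y)) a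
    = derive1n 2 (fun t => ln (l y t) - ln (L t)) a.
  apply: near_eq_derive1n; near=> t.
  have Lt : 0 < L t by near: t.
  have lt : 0 < l y t.
    have : 0 <= l y t /\ (0 < l y t) = (0 < l y a) by near: t; exact: l_supp.
    by case=> _ ->.
  by rewrite /mis_density ln_div.
rewrite /mis_neg_hessian [X in - X]e [X in - X](derive2B _ _ _ _ dl dL).
rewrite [X in - (X - _)]el [X in - (_ - X)]eL.
rewrite L_score0 mul0r expr0n subr0 !opprB.
by rewrite addrC -addrA addrC.
Unshelve. all: by end_near. Qed.

(* Where [l y a = 0], division by 0 gives 0 and the derivatives vanish since the
   support is constant, so both sides are 0. *)
Lemma score_sqrE y :
  (derive1 (l y) a / l y a) ^+ 2 * p y
  = mis_neg_hessian mumis f xobs a y * p y + derive1n 2 (l y) a / L a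
    - derive1n 2 L a / L a * p y.
Proof.
have := l_ge0 y; rewrite le_eqVlt => /predU1P[/esym ly0|ly0].
  have e2 := derive1n_com_likelihood_eq0 y 2 ly0.
  by rewrite e2 /mis_density ly0 !mul0r !mulr0 subr0 addr0.
rewrite mis_neg_hessianE// /mis_density; move: ly0 La_gt0.
move: (l y a) (L a) (derive1 (l y) a) (derive1n 2 (l y) a) (derive1n 2 L a).
move=> u v u1 u2 v2 u0 v0; field.
by rewrite !gt_eqF.
Qed.

Let int_D k : (0 < k <= 2)%N ->
  mumis.-integrable setT (fun y => (derive1n k (l y) a)%:E).
Proof. by have [_ _ h _] := hreg => /h[]. Qed.

(** Integrating [score_sqrE]: differentiation under the integral sign turns the mean of l_y''/L into
    L''/L, which cancels the last term because [p] has mass 1. Integrability of the squared score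
    comes from the same identity. *)
Lemma score_sqr_integral :
  mumis.-integrable setT
    (fun y => ((derive1 (l y) a / l y a) ^+ 2 * p y)%:E) /\
  \int[mumis]_y ((derive1 (l y) a / l y a) ^+ 2 * p y) = mis_fisher mumis f xobs a.
Proof.
have [_ _ h ih] := hreg.
have i2 : mumis.-integrable setT (EFin \o (fun y => derive1n 2 (l y) a / L a)).
  apply: eq_integrable (integrableZl measurableT (L a)^-1 (int_D 2 isT)) => //.
  by move=> y _ /=; rewrite mulrC.
have ic : mumis.-integrable setT (EFin \o (fun y => derive1n 2 L a / L a * p y)).
  exact: (integrableZl measurableT _ integrable_mis_density).
have iS := integrableD measurableT ih i2.
split.
  apply: eq_integrable (integrableB measurableT iS ic) => //.
  by move=> y _ /=; rewrite score_sqrE.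
under eq_Rintegral do rewrite score_sqrE.
rewrite RintegralB// RintegralD// RintegralZl//; last exact: integrable_mis_density.
rewrite RintegralZr//; last exact: int_D.
have [_ <-] := h 2 isT.
by rewrite mis_density_total mulr1 addrK.
Qed.

Lemma cond_expectation_expansion (V : R -> R) (t : R) :
  let r y := R3 V (l y) t a in
  mumis.-integrable setT (fun y => (r y * p y)%:E) ->
  V 1 - cond_expectation mumis f xobs a (fun y => V (LR (l y) t a))
  = (t - a) ^+ 2 / 2 * (derive1 V 1 * obs_fisher mumis f xobs a
                        - derive1n 2 V 1 * mis_fisher mumis f xobs a)
    + \int[mumis]_y (r y * p y).
Proof.
move=> r ir; have [_ _ h ih] := hreg.
have [iS eS] := score_sqr_integral.
(* The definition of [R3] solved for V(LR) and weighted by [p y]. Where [l y a] is 0, the weight and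
   the derivatives all vanish. *)
have E y : V (LR (l y) t a) * p y
    = V 1 * p y + (t - a) * derive1 V 1 / L a * derive1n 1 (l y) a
      + (t - a) ^+ 2 / 2 * derive1 V 1 / L a * derive1n 2 (l y) a
      + (t - a) ^+ 2 / 2 * derive1n 2 V 1 * ((derive1 (l y) a / l y a) ^+ 2 * p y)
      - r y * p y.
  rewrite /r /R3.
  have := l_ge0 y; rewrite le_eqVlt => /predU1P[/esym ly0|ly0].
    rewrite (derive1n_com_likelihood_eq0 y 1 ly0).
    rewrite (derive1n_com_likelihood_eq0 y 2 ly0).
    by rewrite /mis_density ly0 !mul0r !mulr0 !addr0 subr0.
  rewrite derive1n1 /mis_density; move: ly0 La_gt0.
  move: (l y a) (L a) (derive1 (l y) a) (derive1n 2 (l y) a) (V (LR _ _ _)).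
  move: (V 1) (derive1 V 1) (derive1n 2 V 1).
  move=> c c1 c2 u v u1 u2 w u0 v0; field.
  by rewrite !gt_eqF.
have i0 : mumis.-integrable setT (EFin \o (fun y => V 1 * p y)).
  exact: (integrableZl measurableT _ integrable_mis_density).
have i1 c k : (0 < k <= 2)%N ->
    mumis.-integrable setT (EFin \o (fun y => c * derive1n k (l y) a)).
  by move=> k2; exact: (integrableZl measurableT _ (int_D k k2)).
have iq c : mumis.-integrable setT
    (EFin \o (fun y => c * ((derive1 (l y) a / l y a) ^+ 2 * p y))).
  exact: (integrableZl measurableT _ iS).
have j1 c := integrableD measurableT i0 (i1 c 1 isT).
have j2 c c' := integrableD measurableT (j1 c) (i1 c' 2 isT).
have j3 c c' c'' := integrableD measurableT (j2 c c') (iq c'').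
rewrite /cond_expectation; under eq_Rintegral do rewrite E.
rewrite RintegralB//; last exact: j3.
rewrite RintegralD//; last exact: j2.
rewrite RintegralD//; last 2 first.
- exact: j1.
- exact: i1.
rewrite RintegralD//; last exact: i1.
rewrite RintegralZl//; last exact: integrable_mis_density.
rewrite RintegralZl//; last exact: int_D.
rewrite RintegralZl//; last exact: int_D.
rewrite RintegralZl// eS mis_density_total.
(* The first-order term integrates to a multiple of L'(a), which is 0; the second-order one gives
   L''(a), that is, the observed information. *)
have [_ <-] := h 1 isT; have [_ <-] := h 2 isT.
rewrite derive1n1 L_score0 obs_fisherE; move: La_gt0.
move: (L a) (derive1n 2 L a) (mis_fisher _ _ _ _) (\int[_]_y _).
move: (V 1) (derive1 V 1) (derive1n 2 V 1) => c c1 c2 v v2 w w' v0; field.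
by rewrite gt_eqF.
Qed.

End Expansion.

(** * Order of the mean remainder, quotients of expansions, and the observed likelihood ratio *)

Lemma near_norm_sub_le (R : realType) (a e : R) :
  0 < e -> \forall t \near a, `|t - a| <= e.
Proof.
move=> e0; near=> t; rewrite distrC; near: t.
exact: (@cvgr_dist_le _ _ _ (nbhs a) _ id a).
Unshelve. all: by end_near. Qed.

Lemma R3_integral_bound (R : realType) (d1 d2 : measure_display)
    (Tobs : measurableType d1) (Tmis : measurableType d2)
    (mumis : {sigma_finite_measure set Tmis -> \bar R})
    (Theta : set R) (f : R -> Tobs * Tmis -> R) (xobs : Tobs) (a : R) (V : R -> R)
    (r := fun t y => R3 V (com_likelihood f xobs y) t a)
    (p := mis_density mumis f xobs a) :
  (interior Theta) a -> (forall y, 0 <= p y) ->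
  mumis.-integrable setT (fun y => (p y)%:E) ->
  R3_uniformly_integrable mumis f xobs Theta V a ->
  exists M : R, \forall t \near a^',
    mumis.-integrable setT (fun y => (r t y * p y)%:E) /\
    `|\int[mumis]_y (r t y * p y)| <= M * `|t - a| ^+ 3.
Proof.
move=> hint p0 ip hUI; apply: contrapT => /forallNP h.
pose P (M t : R) := mumis.-integrable setT (fun y => (r t y * p y)%:E) /\
  `|\int[mumis]_y (r t y * p y)| <= M * `|t - a| ^+ 3.
(* If no such point existed for some [m], the bound with constant [m] would hold throughout a
   punctured neighbourhood, against the assumption [h]. *)
have /choice[u hu] : forall m : nat, exists t : R,
    [/\ Theta t, t != a, `|t - a| <= m.+1%:R^-1 & ~ P m%:R t].
  move=> m.
  apply: contrapT => /forallNP nt; apply: (h m%:R); near=> t.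
  apply: contrapT => nP; apply: (nt t); split => //.
  - by near: t; exact: nbhs_dnbhs.
  - by near: t; exact: nbhs_dnbhs_neq.
  - by near: t; apply/nbhs_dnbhs/near_norm_sub_le; rewrite invr_gt0.
have UI : uniformly_integrable mumis p (fun m y => r (u m) y / `|u m - a| ^+ 3).
  by apply: hUI => m; have [] := hu m.
have [M hM] := uniformly_integrable_bounded _ _ _ _ _ _ p0 ip UI.
(* Any index above the uniform moment bound [M] contradicts the choice of [u m], whose normalized
   remainder was to violate the bound with constant [m]. *)
pose m := (Num.truncn M).+1.
have Mm : M <= m%:R by rewrite ltW// truncnS_gt.
have [_ uma _] := hu m; apply.
have d0 : 0 < `|u m - a| ^+ 3 by rewrite exprn_gt0// normr_gt0 subr_eq0.
have [/(_ m)[_ iX] _] := UI.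
have E y : r (u m) y * p y
    = `|u m - a| ^+ 3 * (r (u m) y / `|u m - a| ^+ 3 * p y).
  by move: (r (u m) y) (p y) => x z; rewrite mulrA [_ * (x / _)]mulrC divfK// gt_eqF.
split.
  apply: eq_integrable (integrableZl measurableT (`|u m - a| ^+ 3) iX) => //.
  by move=> y _ /=; rewrite E.
under eq_Rintegral do rewrite E.
rewrite RintegralZl// normrM (ger0_norm (ltW d0)) mulrC ler_wpM2r ?(ltW d0)//.
apply: le_trans Mm; apply: le_trans (hM m); exact: le_normr_Rintegral.
Unshelve. all: by end_near. Qed.

(** Multiplying numerator and denominator by 2 / (t - a)^2 turns them into A + O(|t - a|) and B +
    O(|t - a|), and [B] is nonzero. *)
Lemma quotient_expansion (R : realType) (N D : R -> R) (a A B C M : R) :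
  B != 0 ->
  (\forall t \near a^', `|N t - (t - a) ^+ 2 / 2 * A| <= C * `|t - a| ^+ 3) ->
  (\forall t \near a^', `|D t - (t - a) ^+ 2 / 2 * B| <= M * `|t - a| ^+ 3) ->
  exists K, \forall t \near a^', `|N t / D t - A / B| <= K * `|t - a|.
Proof.
move=> B0 hN hD.
have nB0 : 0 < `|B| by rewrite normr_gt0.
(* The numerator of n/d - A/B is (n - A) B - A (d - B), and its denominator [d * B] is at least
   |B|^2 / 2 in absolute value. *)
exists ((2 * C * `|B| + `|A| * (2 * M)) / (`|B| ^+ 2 / 2)).
near=> t.
have ta : t - a != 0 by rewrite subr_eq0; near: t; exact: nbhs_dnbhs_neq.
have nta : 0 < `|t - a| by rewrite normr_gt0.
have scale (F : R -> R) (c K : R) :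
    `|F t - (t - a) ^+ 2 / 2 * c| <= K * `|t - a| ^+ 3 ->
    `|2 * F t / (t - a) ^+ 2 - c| <= 2 * K * `|t - a|.
  move=> hF.
  have -> : 2 * F t / (t - a) ^+ 2 - c
      = (F t - (t - a) ^+ 2 / 2 * c) * (2 / (t - a) ^+ 2) by field.
  rewrite normrM [`|2 / _|]ger0_norm ?divr_ge0 ?sqr_ge0//.
  rewrite -(real_normK (num_real (t - a))) in hF *.
  have -> : 2 * K * `|t - a| = K * `|t - a| ^+ 3 * (2 / `|t - a| ^+ 2).
    by field; rewrite gt_eqF.
  by apply: ler_wpM2r => //; rewrite divr_ge0// sqr_ge0.
have := scale N A C; set n := 2 * _ / _ => hn0.
have {hn0}hn : `|n - A| <= 2 * C * `|t - a| by apply: hn0; near: t.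
have := scale D B M; set d := 2 * _ / _ => hd0.
have {hd0}hd : `|d - B| <= 2 * M * `|t - a| by apply: hd0; near: t.
have dB : `|B| / 2 <= `|d|.
  have : 2 * M * `|t - a| <= `|B| / 2.
    (* The added 1 keeps the divisor positive when [M] is 0, and |M| allows for a negative [M]. *)
    have : `|t - a| <= `|B| / 2 / (2 * `|M| + 1).
      near: t; apply/nbhs_dnbhs/near_norm_sub_le.
      by rewrite !divr_gt0// ltr_wpDl// mulr_ge0.
    rewrite ler_pdivlMr ?ltr_wpDl ?mulr_ge0//; apply: le_trans.
    rewrite mulrC ler_wpM2l//; have := ler_norm M; lra.
  have := ler_normB d (d - B); rewrite subKr; lra.
have d0 : d != 0 by rewrite -normr_gt0; apply: lt_le_trans dB; rewrite divr_gt0.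
have -> : N t / D t = n / d.
  have D0 : D t != 0 by apply: contraNneq d0 => D0; rewrite /d D0 mulr0 mul0r.
  by rewrite /n /d; field; rewrite ta D0.
clearbody n d.
have -> : n / d - A / B = ((n - A) * B - A * (d - B)) / (d * B).
  by field; rewrite d0 B0.
rewrite normrM normfV ler_pdivrMr ?normr_gt0 ?mulf_neq0//.
apply: (@le_trans _ _ ((2 * C * `|B| + `|A| * (2 * M)) * `|t - a|)).
  apply: le_trans (ler_normB _ _) _; rewrite !normrM mulrDl.
  rewrite lerD//; first by rewrite mulrAC ler_wpM2r.
  by rewrite -mulrA ler_wpM2l.
have S0 : 0 <= (2 * C * `|B| + `|A| * (2 * M)) * `|t - a|.
  rewrite mulrDl addr_ge0//.
    by rewrite mulrAC mulr_ge0// (le_trans _ hn).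
  by rewrite -mulrA mulr_ge0// (le_trans _ hd).
set S := (2 * C * `|B| + `|A| * (2 * M)) * `|t - a| in S0 *.
have -> : (2 * C * `|B| + `|A| * (2 * M)) / (`|B| ^+ 2 / 2) * `|t - a| * `|d * B|
    = S * (`|d * B| / (`|B| ^+ 2 / 2)).
  by rewrite /S; move: (`|d * B|) => w; field; rewrite gt_eqF.
rewrite ler_peMr// ler_pdivlMr ?divr_gt0 ?exprn_gt0// mul1r.
rewrite normrM; have := ler_wpM2r (ltW nB0) dB; nra.
Unshelve. all: by end_near. Qed.

(** The ratio [w] satisfies w - 1 = O(d^2) because L'(a) = 0. Hence the quadratic error of [V] at 1
    is O(d^4), and only V'(1) survives at order d^2. *)
Lemma LR_test_expansion (R : realType) (V L : R -> R) (a : R) :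
  times_derivable 2 V 1 -> times_derivable 3 L a -> L a != 0 ->
  derive1 L a = 0 ->
  exists C, \forall t \near a,
    `|V 1 - V (LR L t a) - (t - a) ^+ 2 / 2 * (derive1 V 1 * - (derive1n 2 L a / L a))|
      <= C * `|t - a| ^+ 3.
Proof.
move=> hV hL La0 L1; pose w t := LR L t a.
have [CV CV0 hCV] := taylor_bound1 _ _ _ hV.
have [CL CL0 hCL] := taylor_bound2 _ _ _ hL.
have w1 : w a = 1 by rewrite /w /LR divff.
have cw : {for a, continuous w}.
  have [Ld _] := hL.
  apply: (@continuousM _ _ L (cst (L a)^-1)); last exact: cst_continuous.
  exact: derivable_continuous (nbhs_singleton Ld).
have hCVw : \forall t \near a,
    `|V (w t) - V 1 - derive1 V 1 * (w t - 1)| <= CV * `|w t - 1| ^+ 2.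
  (* The bound for [V] near 1 is pulled back along [w], continuous at [a] with value 1. *)
  by move: hCV; rewrite -{1}w1 => /cw.
pose c := derive1n 2 L a / L a; pose e := CL / `|L a|.
have e0 : 0 <= e by rewrite divr_ge0.
(* The first summand bounds the error of [V], with d^4 lowered to |d|^3 by |d| <= 1; the second is
   V'(1) times the error of [w]. *)
exists (CV * (e + `|c|) ^+ 2 + `|derive1 V 1| * e).
near=> t.
have hw3 : `|w t - 1 - (t - a) ^+ 2 / 2 * c| <= e * `|t - a| ^+ 3.
  have h : `|L t - L a - derive1 L a * (t - a) - derive1n 2 L a / 2 * (t - a) ^+ 2|
      <= CL * `|t - a| ^+ 3 by near: t.
  have -> : w t - 1 - (t - a) ^+ 2 / 2 * c
      = (L t - L a - derive1 L a * (t - a) - derive1n 2 L a / 2 * (t - a) ^+ 2) / L a.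
    by rewrite L1 /w /c /LR; move: (derive1n 2 L a) => c2; field.
  by rewrite normrM normfV /e [leRHS]mulrAC ler_wpM2r// invr_ge0.
have t1 : `|t - a| <= 1 by near: t; exact: near_norm_sub_le.
have t0 : 0 <= `|t - a| by [].
have hw2 : `|w t - 1| <= (e + `|c|) * `|t - a| ^+ 2.
  have q : `|(t - a) ^+ 2 / 2 * c| <= `|c| * `|t - a| ^+ 2.
    rewrite normrM [`|_ / 2|]normrM normrX mulrC ler_wpM2l// [`|_^-1|]ger0_norm//.
    by have := sqr_ge0 `|t - a|; lra.
  have := ler_normD (w t - 1 - (t - a) ^+ 2 / 2 * c) ((t - a) ^+ 2 / 2 * c).
  rewrite subrK => /le_trans; apply; rewrite mulrDl lerD//.
  apply: le_trans hw3 _; rewrite ler_wpM2l// exprS ler_piMl// sqr_ge0.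
have hV2 : `|V (w t) - V 1 - derive1 V 1 * (w t - 1)| <= CV * `|w t - 1| ^+ 2.
  by near: t.
have -> : V 1 - V (LR L t a) - (t - a) ^+ 2 / 2 * (derive1 V 1 * - c)
    = - ((V (w t) - V 1 - derive1 V 1 * (w t - 1))
         + derive1 V 1 * (w t - 1 - (t - a) ^+ 2 / 2 * c)).
  by rewrite -/(w t); clearbody c; move: (w t) (derive1 V 1) => x y; ring.
rewrite normrN mulrDl; apply: le_trans (ler_normD _ _) _; apply: lerD.
  apply: le_trans hV2 _; rewrite -mulrA ler_wpM2l//.
  apply: (@le_trans _ _ (((e + `|c|) * `|t - a| ^+ 2) ^+ 2)).
    by rewrite lerXn2r ?nnegrE// mulr_ge0 ?addr_ge0 ?sqr_ge0.
  rewrite exprMn ler_wpM2l ?sqr_ge0// -exprM (exprS _ 3) ler_piMl// exprn_ge0.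
by rewrite normrM -[leRHS]mulrA ler_wpM2l.
Unshelve. all: by end_near. Qed.

(** * Assembling the expansion of the fraction of test information *)

Theorem theorem1 (R : realType) (d1 d2 : measure_display)
  (Tobs : measurableType d1) (Tmis : measurableType d2)
  (muobs : {sigma_finite_measure set Tobs -> \bar R})
  (mumis : {sigma_finite_measure set Tmis -> \bar R})
  (Theta : set R) (f : R -> Tobs * Tmis -> R)
  (xobs : Tobs) (theta_obs : R) (V : R -> R)
  (hmodel : density_model muobs mumis Theta f)
  (hxobs : forall theta, Theta theta -> 0 < obs_likelihood mumis f xobs theta)
  (hMLE : is_MLE mumis f xobs Theta theta_obs)
  (hint : (interior Theta) theta_obs)
  (hreg : regular_at mumis f xobs theta_obs)
  (hV : evidence_function V)
  (hV1 : times_derivable 2 V 1)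
  (hUI : R3_uniformly_integrable mumis f xobs Theta V theta_obs)
  (hden : derive1 V 1 * obs_fisher mumis f xobs theta_obs
          - derive1n 2 V 1 * mis_fisher mumis f xobs theta_obs != 0) :
  (fun theta0 : R => fraction_test_info mumis f xobs V theta0 theta_obs : R^o)
  = (fun=> derive1 V 1 * obs_fisher mumis f xobs theta_obs
        / (derive1 V 1 * obs_fisher mumis f xobs theta_obs
           - derive1n 2 V 1 * mis_fisher mumis f xobs theta_obs))
    +O_ (theta_obs^') (fun theta0 : R => `|theta0 - theta_obs| : R^o).
Proof.
have [Tobs0 obs_max] := hMLE.
have nT : \forall t \near theta_obs, Theta t by exact: hint.
have [hmd hsupp] := hmodel.
have nL : \forall t \near theta_obs, 0 < obs_likelihood mumis f xobs t.
  by apply: filterS nT => t; exact: hxobs.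
have ml : measurable_fun setT (fun y => com_likelihood f xobs y theta_obs).
  have [mf _ _] := hmd _ Tobs0.
  exact: (measurableT_comp mf (pair1_measurable xobs)).
have supp y : \forall t \near theta_obs, 0 <= com_likelihood f xobs y t /\
    (0 < com_likelihood f xobs y t) = (0 < com_likelihood f xobs y theta_obs).
  by apply: filterS nT => t Tt; have [_ f0 _] := hmd _ Tt; split; [exact: f0|exact: hsupp].
have [hL _ _ _] := hreg.
have L1 : derive1 (obs_likelihood mumis f xobs) theta_obs = 0.
  (* The estimate is interior to [Theta], so the global maximum over [Theta] is a local one and the
     score vanishes. *)
  by have [Ld _] := hL; apply: derive1_local_max => //; apply: filterS nT => t; exact: obs_max.
have La := nbhs_singleton nL.
have [C hC] := LR_test_expansion _ _ _ _ hV1 hL (lt0r_neq0 La) L1.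
have p0 := mis_density_ge0 _ _ _ _ _ mumis f xobs theta_obs nL supp.
have ip := integrable_mis_density _ _ _ _ _ mumis f xobs theta_obs nL ml supp.
have [M hM] := R3_integral_bound _ _ _ _ _ _ _ _ _ _ _ hint p0 ip hUI.
have eI := obs_fisherE _ _ _ _ _ mumis f xobs theta_obs nL hreg L1.
(* The denominator of the fraction: in the sum of observed and conditional information the terms
   V(LR(x_obs)) cancel. *)
pose D t := V 1 - cond_expectation mumis f xobs theta_obs
  (fun y => V (LR (com_likelihood f xobs y) t theta_obs)).
have hD : \forall t \near theta_obs^',
    `|D t - (t - theta_obs) ^+ 2 / 2 *
       (derive1 V 1 * obs_fisher mumis f xobs theta_obs
        - derive1n 2 V 1 * mis_fisher mumis f xobs theta_obs)|
    <= M * `|t - theta_obs| ^+ 3.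
  apply: filterS hM => t [it].
  rewrite /D (cond_expectation_expansion _ _ _ _ _ mumis f xobs theta_obs nL ml supp hreg L1 V t it).
  by rewrite addrAC subrr add0r.
have hN : \forall t \near theta_obs^',
    `|obs_test_info mumis f xobs V t theta_obs - (t - theta_obs) ^+ 2 / 2 *
       (derive1 V 1 * obs_fisher mumis f xobs theta_obs)|
    <= C * `|t - theta_obs| ^+ 3.
  by rewrite eI; exact: nbhs_dnbhs.
have [K hK] := quotient_expansion _ _ _ _ _ _ _ _ hden hN hD.
(* The O-relation asks for all large constants [k]; it is enough that [k] exceeds [K]. *)
apply/eqaddOP; near=> k; near=> t.
have : `|obs_test_info mumis f xobs V t theta_obs / D t -
    derive1 V 1 * obs_fisher mumis f xobs theta_obs
    / (derive1 V 1 * obs_fisher mumis f xobs theta_obs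
       - derive1n 2 V 1 * mis_fisher mumis f xobs theta_obs)| <= K * `|t - theta_obs|.
  by near: t.
have -> : D t = obs_test_info mumis f xobs V t theta_obs
    + cond_test_info mumis f xobs V t theta_obs.
  by rewrite /obs_test_info /cond_test_info addrA subrK.
rewrite normr_id => /le_trans; apply.
by rewrite ler_wpM2r//; near: k; exact: nbhs_pinfty_ge.
Unshelve. all: by end_near. Qed.
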